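(* Let $a,b,c$ be positive integers, $q_1,\dots,q_c\in(0,1)$, and let $\pi$ be distributed according to the $g$-measure $\mathrm P_{g,b,c}$ on $\mathrm{PP}(\infty,b,c)$, with shape $\lambda=(\lambda_1\ge\cdots\ge\lambda_b\ge0)$. Then $$\mathrm P_{g,b,c}(\lambda_1\le a)=\frac{1}{Z_{b,c}}\,s_{(a^b)}(1^b,q_1,\dots,q_c),$$ where $s_{(a^b)}$ is the Schur polynomial of the rectangular partition with $b$ parts equal to $a$, and $1^b$ denotes $b$ variables equal to $1$.
   Context: $\mathrm{PP}(\infty,b,c)$ is the set of plane partitions (arrays $(\pi_{ij})_{i,j\ge1}$ of nonnegative integers, finitely many nonzero, weakly decreasing along rows and columns) with at most $b$ nonzero rows and entries at most $c$; the shape of $\pi$ is the partition $\lambda$ with $\lambda_i=|\{j:\pi_{ij}>0\}|$. $\mathrm{Des}(\pi)=\{(i,j):\pi_{ij}>\pi_{i+1,j}\}$. The $g$-measure is $\mathrm P_{g,b,c}(\pi)=Z_{b,c}^{-1}\prod_{(i,j)\in\mathrm{Des}(\pi)}q_{\pi_{ij}}$, where $Z_{b,c}$ is the normalizing constant. *)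

(* Defs.v *)
From HB Require Import structures.
From mathcomp Require Import all_boot all_order all_algebra.
From mathcomp Require Import finmap.
From mathcomp Require Import all_classical all_reals all_analysis.

Set Implicit Arguments.
Unset Strict Implicit.
Unset Printing Implicit Defensive.

Import Order.TTheory GRing.Theory Num.Theory.
Local Open Scope classical_set_scope.
Local Open Scope card_scope.
Local Open Scope ring_scope.

(* Rows and columns are numbered from 0: pi i j is the entry written
   pi_{i+1,j+1} with the usual numbering from 1. *)
Definition is_plane_partition (pi : nat -> nat -> nat) : Prop :=
  [/\ finite_set [set u : nat * nat | (0 < pi u.1 u.2)%N],
      forall i j, (pi i j.+1 <= pi i j)%N &
      forall i j, (pi i.+1 j <= pi i j)%N].

Record PP (b c : nat) := MkPP {
  pp_entry :> nat -> nat -> nat;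
  pp_is_pp : is_plane_partition pp_entry;
  pp_rows : [set i | exists j, (0 < pp_entry i j)%N] #<= `I_b;
  pp_le : forall i j, (pp_entry i j <= c)%N }.

HB.instance Definition _ b c := gen_eqMixin (PP b c).
HB.instance Definition _ b c := gen_choiceMixin (PP b c).

Definition pp_shape (pi : nat -> nat -> nat) (i : nat) : nat :=
  #|` fset_set [set j | (0 < pi i j)%N]|.

Definition Des (pi : nat -> nat -> nat) : set (nat * nat) :=
  [set u | (pi u.1 u.2 > pi u.1.+1 u.2)%N].

(* The parameters q_1, ..., q_c are the entries of q, numbered from 0. On Des
   pi the entries of pi are positive, so the predecessor is not truncated. *)
Definition gweight (R : realType) (b c : nat) (q : c.-tuple R)
    (pi : PP b c) : R :=
  \big[*%R/1]_(u \in Des pi) q`_(pi u.1 u.2).-1.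

Definition gZ (R : realType) (b c : nat) (q : c.-tuple R) : R :=
  fine (\esum_(pi in [set: PP b c]) (gweight q pi)%:E).

(* The hypothesis on q does not occur in the formula; it is an argument so that
   gmeasure hq is canonically a probability measure (see below). *)
Definition gmeasure (R : realType) (b c : nat) (q : c.-tuple R)
    (hq : forall k, 0 < tnth q k < 1) (A : set (PP b c)) : \bar R :=
  \esum_(pi in A) ((gZ b q)^-1 * gweight q pi)%:E.

(* Schur polynomials, as sums over semistandard Young tableaux. A cell of the
   diagram of la is a row index together with a column index in that row. *)
Definition cell (la : seq nat) : Type :=
  {i : 'I_(size la) & 'I_(tnth (in_tuple la) i)}.
HB.instance Definition _ la := Finite.on (cell la).

Definition cell_row la (u : cell la) : nat := tag u.
Definition cell_col la (u : cell la) : nat := tagged u.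

Definition is_ssyt (la : seq nat) (n : nat) (T : {ffun cell la -> 'I_n}) :=
  [forall u, forall v,
    ((cell_row u == cell_row v) && (cell_col u <= cell_col v)%N
       ==> (T u <= T v)%N) &&
    ((cell_col u == cell_col v) && (cell_row u < cell_row v)%N
       ==> (T u < T v)%N)].

Definition schur (R : comNzRingType) (la : seq nat) (n : nat)
    (x : n.-tuple R) : R :=
  \sum_(T : {ffun cell la -> 'I_n} | is_ssyt T) \prod_u tnth x (T u).

Lemma pp0_is_pp : is_plane_partition (fun _ _ => 0%N).
Proof.
split=> //.
by rewrite (_ : [set _ | _] = set0)//; apply/seteqP; split.
Qed.

Lemma pp0_rows b :
  [set i | exists j : nat, (0 < (fun _ _ : nat => 0) i j)%N] #<= `I_b.
Proof.
rewrite (_ : [set _ | _] = set0) ?card_le0x//.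
by apply/seteqP; split => // i [].
Qed.

Definition pp0 b c : PP b c :=
  @MkPP b c (fun _ _ => 0%N) pp0_is_pp (pp0_rows b) (fun _ _ => leq0n c).

HB.instance Definition _ b c := isPointed.Build (PP b c) (pp0 b c).
HB.instance Definition _ b c := @isMeasurable.Build default_measure_display
  (PP b c) discrete_measurable discrete_measurable0
  discrete_measurableC discrete_measurableU.

(* The normalizing constant is finite: for each row i and each value v, let
   m i v be the number of columns j with pi i j = v > pi i.+1 j. Then pi is
   determined by m, and the weight of pi is the product of the q_v ^+ m i v. *)
Lemma pp_inj b c (p1 p2 : PP b c) : (forall i j, p1 i j = p2 i j) -> p1 = p2.
Proof.
case: p1 p2 => [f1 h1 r1 l1] [f2 h2 r2 l2] /= e.
have ef : f1 = f2 by apply/funext => i; apply/funext.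
by subst f2; congr MkPP; exact: Prop_irrelevance.
Qed.

Lemma pp_homo_row b c (p : PP b c) i j k : (j <= k)%N -> (p i k <= p i j)%N.
Proof.
case: p => f [fin hr hc] hb hle /=.
move=> /subnK <-; elim: (k - j)%N => // d; exact: leq_trans (hr _ _).
Qed.

Lemma pp_homo_col b c (p : PP b c) i k j : (i <= k)%N -> (p k j <= p i j)%N.
Proof.
case: p => f [fin hr hc] hb hle /=.
move=> /subnK <-; elim: (k - i)%N => // d; exact: leq_trans (hc _ _).
Qed.

Lemma pp_row0 b c (p : PP b c) i j : (b <= i)%N -> p i j = 0%N.
Proof.
move=> bi; apply/eqP; rewrite -leqn0 leqNgt; apply/negP => pij.
have : `I_b.+1 #<= `I_b.
  apply: card_le_trans (pp_rows p); apply: subset_card_le => k /= kb.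
  exists j; apply: leq_trans pij _; apply: pp_homo_col.
  by apply: leq_trans bi; rewrite -ltnS.
by rewrite card_le_II ltnn.
Qed.

Lemma pp_col_bound b c (p : PP b c) :
  exists N, forall i j, (N <= j)%N -> p i j = 0%N.
Proof.
have [fin _ _] := pp_is_pp p.
have [N hN] : exists N, forall j, (0 < p 0%N j)%N -> (j < N)%N.
  pose X := fset_set [set u : nat * nat | (0 < p u.1 u.2)%N].
  exists (\max_(u <- X) u.2).+1 => j pj; rewrite ltnS.
  have : (0%N, j) \in X by rewrite in_fset_set// inE.
  by move=> h; rewrite (big_rem _ h)/= leq_maxl.
exists N => i j Nj; apply/eqP; rewrite -leqn0.
rewrite (leq_trans (pp_homo_col p j (leq0n i)))// leqNgt.
by apply/negP => /hN; rewrite ltnNge Nj.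
Qed.

Definition pp_mult b c (N : nat) (p : PP b c) (i v : nat) : nat :=
  #|[set j : 'I_N | (p i j == v.+1) && (p i.+1 j < p i j)%N]%SET|.

Lemma pp_mult_inj b c N (p1 p2 : PP b c) :
  (forall i j, (N <= j)%N -> p1 i j = 0%N) ->
  (forall i j, (N <= j)%N -> p2 i j = 0%N) ->
  (forall i v, (i < b)%N -> (v < c)%N -> pp_mult N p1 i v = pp_mult N p2 i v) ->
  p1 = p2.
Proof.
move=> z1 z2 em; apply: pp_inj.
have step (p p' : PP b c) (i v j : nat) : (i < b)%N -> (v < c)%N ->
    (forall i j, (N <= j)%N -> p i j = 0%N) ->
    pp_mult N p i v = pp_mult N p' i v ->
    (forall j, p i.+1 j = p' i.+1 j) ->
    (forall j, (v.+1 < p i j)%N = (v.+1 < p' i j)%N) ->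
    (v < p i j)%N -> (v < p' i j)%N.
  move=> ib vc z e er ev vp; rewrite ltnNge; apply/negP => vp'.
  have jN : (j < N)%N by rewrite ltnNge; apply/negP => /z h; rewrite h in vp.
  have : (pp_mult N p' i v < pp_mult N p i v)%N.
    apply: proper_card; apply/properP; split; last first.
      exists (Ordinal jN); rewrite !inE/=; last first.
        by apply/negP => /andP[/eqP h _]; rewrite h ltnn in vp'.
      have -> : p i j = v.+1.
        by apply/eqP; rewrite eqn_leq vp andbT leqNgt ev -leqNgt leqW.
      by rewrite eqxx er ltnS (leq_trans _ vp')// pp_homo_col.
    apply/fintype.subsetP => k; rewrite !inE => /andP[/eqP h h'].
    have kj : (k < j)%N.
      rewrite ltnNge; apply/negP => /(pp_homo_row p' i).
      by rewrite h => /leq_trans/(_ vp'); rewrite ltnn.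
    have -> : p i k = v.+1.
      apply/eqP; rewrite eqn_leq (leq_trans vp (pp_homo_row _ _ (ltnW kj))) andbT.
      by rewrite leqNgt ev h ltnn.
    by rewrite eqxx er -h.
  by rewrite e ltnn.
have row i d : (b <= i + d)%N -> forall j, p1 i j = p2 i j.
  elim: d i => [|d IH] i.
    by rewrite addn0 => bi j; rewrite !pp_row0.
  rewrite addnS -addSn => /IH er.
  have [bi j|ib] := leqP b i; first by rewrite !pp_row0.
  have lev v e : (c <= v + e)%N -> forall j, (v < p1 i j)%N = (v < p2 i j)%N.
    elim: e v => [|e IHe] v.
      rewrite addn0 => cv j.
      by rewrite !ltnNge !(leq_trans (pp_le _ _ _) cv).
    rewrite addnS -addSn => /IHe ev j.
    have [cv|vc] := leqP c v.
      by rewrite !ltnNge !(leq_trans (pp_le _ _ _) cv).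
    apply/idP/idP; apply: step => //; first exact: em.
    by rewrite em.
  move=> j; apply/eqP; rewrite eqn_leq (leqNgt (p1 i j)) (leqNgt (p2 i j)).
  have cv v : (c <= v + c)%N by exact: leq_addl.
  by rewrite (lev _ _ (cv _)) ltnn -(lev _ _ (cv _)) ltnn.
by move=> i; apply: (row i b); exact: leq_addl.
Qed.

Section normalization.
Context (R : realType) (b c : nat) (q : c.-tuple R).
Hypothesis hq : forall k, 0 < tnth q k < 1.
Local Open Scope fset_scope.

Lemma q_nth_gt0 v : (v < c)%N -> 0 < q`_v < 1.
Proof. by move=> vc; have := hq (Ordinal vc); rewrite (tnth_nth 0). Qed.

Lemma Des_finite (p : PP b c) : finite_set (Des p).
Proof.
have [fin _ _] := pp_is_pp p.
by apply: sub_finite_set fin => u /=; exact: leq_ltn_trans.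
Qed.

Lemma gweight_gt0 (p : PP b c) : 0 < gweight q p.
Proof.
rewrite /gweight fsbig_finite; last exact: Des_finite.
rewrite big_seq; apply: prodr_gt0 => u.
rewrite in_fset_set; last exact: Des_finite.
rewrite inE => /(leq_ltn_trans (leq0n _)) pu.
have := @q_nth_gt0 (p u.1 u.2).-1.
by rewrite prednK// pp_le => /(_ isT)/andP[].
Qed.

Lemma gweight_mult N (p : PP b c) :
  (forall i j, (N <= j)%N -> p i j = 0%N) ->
  gweight q p = \prod_(u : 'I_b * 'I_c) tnth q u.2 ^+ pp_mult N p u.1 u.2.
Proof.
move=> z; rewrite /gweight fsbig_finite; last exact: Des_finite.
pose D := [seq (val u.1, val u.2) | u : 'I_b * 'I_N <- enum {: 'I_b * 'I_N}
                                  & (p u.1.+1 u.2 < p u.1 u.2)%N].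
rewrite (perm_big D); last first.
  apply: uniq_perm; first exact: fset_uniq.
    rewrite map_inj_in_uniq ?filter_uniq -?enumT ?enum_uniq//.
    by move=> [i j] [i' j'] _ _ [/val_inj -> /val_inj ->].
  move=> [i j]; rewrite in_fset_set; last exact: Des_finite.
  apply/idP/mapP => [|[[i' j'] + [-> ->]]]; last first.
    by rewrite mem_filter/= => /andP[h _]; rewrite inE.
  rewrite inE /Des/= => h.
  have ib : (i < b)%N.
    by rewrite ltnNge; apply/negP => bi; rewrite [p i j]pp_row0 in h.
  have jN : (j < N)%N.
    by rewrite ltnNge; apply/negP => Nj; rewrite [p i j]z in h.
  exists (Ordinal ib, Ordinal jN) => //.
  by rewrite mem_filter/= h mem_enum.
rewrite big_map big_filter big_enum_cond/=.
transitivity (\prod_(i < b) \prod_(j < N | (p i.+1 j < p i j)%N) q`_(p i j).-1).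
  by rewrite pair_big_dep.
transitivity (\prod_(i < b) \prod_(v < c) tnth q v ^+ pp_mult N p i v);
  last by rewrite pair_bigA.
apply: eq_bigr => i _.
transitivity (\prod_(j < N | (p i.+1 j < p i j)%N)
    \prod_(v < c | p i j == v.+1) tnth q v).
  apply: eq_bigr => j h.
  have p0 : (0 < p i j)%N by exact: leq_ltn_trans h.
  have hv : ((p i j).-1 < c)%N by rewrite prednK// pp_le.
  rewrite (big_pred1 (Ordinal hv)) ?(tnth_nth 0)// => v /=.
  by rewrite -val_eqE/= -[in LHS](prednK p0) eqSS eq_sym.
rewrite (exchange_big_dep xpredT)//=; apply: eq_bigr => v _.
rewrite prodr_const; congr (_ ^+ _); apply: eq_card => j.
by rewrite !inE andbC.
Qed.

Lemma gweight_fsum_le (A : seq (PP b c)) : uniq A ->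
  \sum_(p <- A) gweight q p <= \prod_(u : 'I_b * 'I_c) (1 - tnth q u.2)^-1.
Proof.
move=> uA.
have [N hN] : exists N, forall p, p \in A ->
    forall i j, (N <= j)%N -> p i j = 0%N.
  elim: A {uA} => [|p A [N IH]]; first by exists 0%N.
  have [M hM] := pp_col_bound p.
  exists (maxn N M) => p' + i j; rewrite inE geq_max.
  by move=> /predU1P[->|/IH h] /andP[h1 h2]; [exact: hM|exact: h].
pose f (p : PP b c) : {ffun 'I_b * 'I_c -> 'I_N.+1} :=
  [ffun u : 'I_b * 'I_c => inord (pp_mult N p u.1 u.2)].
have fE p u : f p u = pp_mult N p u.1 u.2 :> nat.
  by rewrite ffunE inordK// ltnS -[leqRHS]card_ord max_card.
pose w (g : {ffun 'I_b * 'I_c -> 'I_N.+1}) : R :=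
  \prod_u tnth q u.2 ^+ g u.
have w0 g : 0 <= w g.
  by apply: prodr_ge0 => u _; apply: exprn_ge0; case/andP: (hq u.2) => /ltW.
have ufA : uniq (map f A).
  rewrite map_inj_in_uniq// => p p' pA p'A e.
  apply: (@pp_mult_inj _ _ N); [exact: hN|exact: hN|move=> i v ib vc].
  by rewrite -(fE p (Ordinal ib, Ordinal vc)) e fE.
have -> : \sum_(p <- A) gweight q p = \sum_(g <- map f A) w g.
  rewrite big_map big_seq [RHS]big_seq; apply: eq_bigr => p pA.
  rewrite (gweight_mult (hN _ pA)); apply: eq_bigr => u _.
  by rewrite fE.
rewrite (le_trans (_ : _ <= \sum_g w g))//.
  rewrite [leLHS](big_uniq _ ufA)/= [leRHS](bigID (mem (map f A)))/=.
  by rewrite lerDl sumr_ge0.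
rewrite -(bigA_distr_bigA (fun u (k : 'I_N.+1) => tnth q u.2 ^+ k))/=.
apply: ler_prod => -[i v] _ /=; have /andP[q0 q1] := hq v.
rewrite sumr_ge0/=; last by move=> k _; rewrite exprn_ge0// ltW.
rewrite -[leRHS]mul1r ler_pdivlMr ?subr_gt0// mulrC.
by rewrite -opprB mulNr -subrX1 opprB gerBl exprn_ge0// ltW.
Qed.

Lemma gZ_lty : (\esum_(pi in [set: PP b c]) (gweight q pi)%:E < +oo)%E.
Proof.
apply: (@le_lt_trans _ _ (\prod_(u : 'I_b * 'I_c) (1 - tnth q u.2)^-1)%:E);
  last exact: ltry.
apply: ge_ereal_sup => _ [A [finA _] <-].
rewrite fsbig_finite//= sumEFin lee_fin.
exact: gweight_fsum_le (fset_uniq _).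
Qed.

Lemma gZ_EFin : (gZ b q)%:E = \esum_(pi in [set: PP b c]) (gweight q pi)%:E.
Proof.
rewrite fineK// ge0_fin_numE ?gZ_lty//.
by apply: esum_ge0 => p _; rewrite lee_fin ltW// gweight_gt0.
Qed.

Lemma gZ_gt0 : 0 < gZ b q.
Proof.
rewrite -lte_fin gZ_EFin.
apply: (@lt_le_trans _ _ (gweight q (pp0 b c))%:E).
  by rewrite lte_fin gweight_gt0.
apply: esum_ge; exists [set pp0 b c]; last by rewrite fsbig_set1.
by split.
Qed.

Let gmeasure0 : gmeasure hq (@set0 (PP b c)) = 0%E.
Proof. exact: esum_set0. Qed.

Let gterm_ge0 (p : PP b c) : (0 <= ((gZ b q)^-1 * gweight q p)%:E)%E.
Proof. by rewrite lee_fin mulr_ge0 ?invr_ge0 ?ltW ?gZ_gt0 ?gweight_gt0. Qed.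

Let gmeasure_ge0 (A : set (PP b c)) : (0 <= gmeasure hq A)%E.
Proof. by apply: esum_ge0 => p _. Qed.

Let gmeasure_sigma_additive : semi_sigma_additive (@gmeasure R b c q hq).
Proof.
move=> F _ tF _.
rewrite /gmeasure esum_bigcupT// -nneseries_esumT//.
  by apply: is_cvg_nneseries => n _ _; exact: gmeasure_ge0.
by move=> n; exact: gmeasure_ge0.
Qed.

HB.instance Definition _ := isMeasure.Build _ _ _ (@gmeasure R b c q hq)
  gmeasure0 gmeasure_ge0 gmeasure_sigma_additive.

Let gmeasure_setT : gmeasure hq [set: PP b c] = 1%E.
Proof.
rewrite /gmeasure /esum.
under eq_imagel => A [finA _].
  under eq_fsbigr do rewrite EFinM.
  rewrite -ge0_mule_fsumr; last by move=> p; rewrite lee_fin ltW// gweight_gt0.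
  over.
rewrite -(image_comp (fun A => \sum_(p \in A) (gweight q p)%:E)%E).
rewrite ereal_sup_pZl ?invr_gt0 ?gZ_gt0// -/(esum _ _) -gZ_EFin -EFinM.
by rewrite mulVf// gt_eqF// gZ_gt0.
Qed.

HB.instance Definition _ := Measure_isProbability.Build _ _ R
  (@gmeasure R b c q hq) gmeasure_setT.

End normalization.

(* Main.v *)
(** A plane partition with [lambda_1 <= a] is a decreasing [b] x [a] array with
    entries at most [c]; so is a tableau of shape [a^b], after subtracting the
    row index and rotating by 180 degrees. Replace each row by its conjugate, so that a
    box array becomes a [b] x [c] array [f] with entries at most [a]. The
    [g]-weight is then [\prod_v q_v ^ m_v], where [m_v] is the [v]-th column sum
    of [f i j - max (f (i+1) j) (f i (j+1))], and the tableau weight is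
    [\prod_v q_v ^ (D_v - D_(v+1))], where [D_v] is the sum of [f] along the
    diagonal starting at [(0, v)]. The Robinson-Schensted-Knuth correspondence,
    written as a composition of piecewise linear toggles of diagonals, permutes
    these arrays and carries the first statistic to the second. *)
Require Import Defs.
From HB Require Import structures.
From mathcomp Require Import all_boot all_order all_algebra.
From mathcomp Require Import all_classical all_reals all_analysis.
From mathcomp Require Import zify.

Set Implicit Arguments.
Unset Strict Implicit.
Unset Printing Implicit Defensive.

Import Order.TTheory GRing.Theory Num.Theory.
Local Open Scope classical_set_scope.
Local Open Scope nat_scope.

(** * Box arrays and toggles of their diagonals *)

Definition box (b a c : nat) : set (nat -> nat -> nat) :=
  [set f | [/\ forall i j, f i j.+1 <= f i j, forall i j, f i.+1 j <= f i j,
    forall i j, f i j <= c & forall i j, (b <= i) || (a <= j) -> f i j = 0]].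

Lemma set_involution_bij (T : Type) (A : set T) (f : T -> T) :
  {homo f : x / A x} -> (forall x, A x -> f (f x) = x) -> set_bij A A f.
Proof.
move=> fA fK; split=> [//|x y|y Ay]; last by exists (f y); [exact: fA|exact: fK].
by rewrite !inE => Ax Ay e; rewrite -(fK x)// e fK.
Qed.

(* The entries strictly below [(i, j)] on its diagonal are toggled at once, which
   is harmless because they are not adjacent to one another. *)
Definition toggle (i j : nat) (f : nat -> nat -> nat) (k l : nat) : nat :=
  if (i < k) && (k + j == l + i)
  then minn (f k.-1 l) (f k l.-1) + maxn (f k.+1 l) (f k l.+1) - f k l
  else f k l.

(** A toggle reflects an entry in the interval from its larger successor to its smaller predecessor;
    both ends lie on other diagonals and stay fixed. Outside the box the smaller predecessor is
    already 0. *)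
Lemma toggle_box b a c i j f : box b a c f -> box b a c (toggle i j f).
Proof.
case=> hr hc hle h0.
have hp k l : 0 < k -> f k l <= f k.-1 l by case: k.
have hq k l : 0 < l -> f k l <= f k l.-1 by case: l.
split=> k l; rewrite /toggle.
- case: ifPn => h1; case: ifPn => h2 /=; try lia; last exact: hr.
    have := hr k l.+1; have := hc k l.+1; have := hq k l.+1; lia.
  have := hq k l; have := hp k l; have := hr k l; lia.
- case: ifPn => h1; case: ifPn => h2 /=; try lia; last exact: hc.
    have := hr k.+1 l; have := hc k.+1 l; have := hp k.+1 l; lia.
  have := hq k l; have := hp k l; have := hc k l; lia.
- case: ifPn => // h; have := hp k l; have := hq k l.
  have := hr k l; have := hc k l; have := hle k.-1 l; lia.
- move=> kl; case: ifPn => [h|_]; last exact: h0.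
  have := h0 k l kl; have := h0 k.+1 l; have := h0 k l.+1.
  have := h0 k l.-1; have := h0 k.-1 l.
  by have := hr k l; have := hc k l; lia.
Qed.

Lemma toggleK b a c i j f : box b a c f -> toggle i j (toggle i j f) = f.
Proof.
case=> hr hc hle h0.
have hp k l : 0 < k -> f k l <= f k.-1 l by case: k.
have hq k l : 0 < l -> f k l <= f k l.-1 by case: l.
apply/funext => k; apply/funext => l; rewrite {1}/toggle.
case: ifPn => h; last by rewrite /toggle (negbTE h).
have nt k' l' : k' + j != l' + i -> toggle i j f k' l' = f k' l'.
  by move=> e; rewrite /toggle (negbTE e) andbF.
rewrite (nt k.-1) ?(nt k l.-1) ?(nt k.+1) ?(nt k l.+1); try lia.
rewrite /toggle h; have := hp k l; have := hq k l.
have := hr k l; have := hc k l; lia.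
Qed.

(** * Exchange of gaps and diagonal sums under toggles *)

Definition diag_sum (b : nat) (f : nat -> nat -> nat) (i j : nat) : nat :=
  \sum_(k < b) f (i + k) (j + k).

(** On a box, [f] is the last-passage time built from these weights: [f i j = maxn (f i.+1 j) (f i
    j.+1) + gap f i j]. *)
Definition gap (f : nat -> nat -> nat) (i j : nat) : nat :=
  f i j - maxn (f i.+1 j) (f i j.+1).

Lemma diag_sumS b a c f i j : box b a c f ->
  diag_sum b f i j = f i j + diag_sum b f i.+1 j.+1.
Proof.
case=> _ _ _ h0; rewrite /diag_sum.
have -> : \sum_(k < b) f (i + k) (j + k) = \sum_(k < b.+1) f (i + k) (j + k).
  by rewrite big_ord_recr/= [X in _ + X]h0 ?addn0// leq_addl.
rewrite big_ord_recl/= !addn0; congr addn; apply: eq_bigr => k _.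
by rewrite /bump/= !addSnnS.
Qed.

(** Makes the truncated differences of diagonal sums in the exponents exact. *)
Lemma leq_diag_sum b a c f i j : box b a c f ->
  diag_sum b f i j.+1 <= diag_sum b f i j.
Proof. by case=> hr _ _ _; apply: leq_sum => k _; rewrite addSn. Qed.

Lemma diag_sum_toggle b f i j k l : l + i <> k + j ->
  diag_sum b (toggle i j f) k l = diag_sum b f k l.
Proof.
move=> h; apply: eq_bigr => t _; rewrite /toggle ifF//.
by apply/negP => /andP[_ /eqP]; lia.
Qed.

Lemma gap_toggle f i j k l : k < i \/ k = i /\ l <= j ->
  gap (toggle i j f) k l = gap f k l.
Proof.
by move=> h; rewrite /gap /toggle !ifF//; apply/negP => /andP[? /eqP]; lia.
Qed.

(** Shifting the maxima by one index pairs the minimum and maximum of the same two numbers, whose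
    sum is [u k + w k]. *)
Lemma sum_min_max (u w : nat -> nat) n :
  maxn (u 0) (w 0) +
    \sum_(k < n) (minn (u k) (w k) + maxn (u k.+1) (w k.+1)) =
  \sum_(k < n) (u k + w k) + maxn (u n) (w n).
Proof.
elim: n => [|n IH]; first by rewrite !big_ord0 addn0.
rewrite !big_ord_recr/= addnA IH -addnA -[RHS]addnA; congr addn; lia.
Qed.

(* Fomin's growth rule: the predecessors of a diagonal entry are the successors
   of the preceding one, so the minima and maxima in the toggles pair up. *)
Lemma diag_sum_growth b a c f i j : box b a c f ->
  diag_sum b (toggle i j f) i j + diag_sum b f i.+1 j.+1 =
  gap f i j + diag_sum b f i.+1 j + diag_sum b f i j.+1.
Proof.
move=> bf; have btf := toggle_box i j bf.
rewrite (diag_sumS _ _ btf).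
have -> : toggle i j f i j = f i j by rewrite /toggle ltnn.
have [hr hc hle h0] := bf.
(* [X] adds up old entry plus toggled entry along the diagonal strictly below [(i, j)]. *)
set X := \sum_(k < b) (minn (f (i + k).+1 (j + k)) (f (i + k) (j + k).+1) +
  maxn (f (i + k.+1).+1 (j + k.+1)) (f (i + k.+1) (j + k.+1).+1)).
have e : maxn (f i.+1 j) (f i j.+1) + X =
    diag_sum b f i.+1 j + diag_sum b f i j.+1.
  have := sum_min_max (fun k => f (i + k).+1 (j + k))
    (fun k => f (i + k) (j + k).+1) b.
  rewrite /= !addn0 (h0 (i + b).+1) ?(h0 (i + b)) ?maxn0 ?addn0; try lia.
  by rewrite [X in _ = X]big_split.
suff : diag_sum b (toggle i j f) i.+1 j.+1 + diag_sum b f i.+1 j.+1 = X.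
  by rewrite /gap; have := hr i j; have := hc i j; lia.
rewrite -big_split/=; apply: eq_bigr => k _.
rewrite /toggle ifT; last by lia.
rewrite !addSn !addnS/=.
have := hc (i + k).+1 (j + k).+1; have := hr (i + k).+1 (j + k).+1.
by have := hc (i + k) (j + k).+1; have := hr (i + k).+1 (j + k); lia.
Qed.

(* The exponent of [q_v] once the cells [(k, l)] with [k > i], or with [k = i] and
   [l >= j], have been toggled in turn. *)
Definition hybrid_exponent b f (i j v : nat) : nat :=
  \sum_(k < i) gap f k v +
  (if v < j then gap f i v + diag_sum b f i.+1 v - diag_sum b f i.+1 v.+1
   else diag_sum b f i v - diag_sum b f i v.+1).

(** Only [v = j] needs the growth rule; every other exponent reads entries that [toggle i j] leaves
    alone. *)
Lemma hybrid_exponent_toggle b a c f i j v : box b a c f ->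
  hybrid_exponent b (toggle i j f) i j v = hybrid_exponent b f i j.+1 v.
Proof.
move=> bf; rewrite /hybrid_exponent; congr addn.
  by apply: eq_bigr => k _; rewrite gap_toggle//; left.
rewrite ltnS; case: (ltngtP v j) => h.
- by rewrite gap_toggle ?diag_sum_toggle//; lia.
- by rewrite !diag_sum_toggle//; lia.
- rewrite h (diag_sum_toggle _ _ (l := j.+1)); last by lia.
  have := diag_sum_growth i j bf; have := leq_diag_sum i.+1 j bf.
  have := leq_diag_sum i j (toggle_box i j bf).
  by rewrite (diag_sum_toggle _ _ (l := j.+1)); lia.
Qed.

Lemma hybrid_exponent_row b a c f i v : box b a c f -> v < a ->
  hybrid_exponent b f i a v = hybrid_exponent b f i.+1 0 v.
Proof.
move=> bf va; rewrite /hybrid_exponent va/= big_ord_recr/= -addnA.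
by have := leq_diag_sum i.+1 v bf; lia.
Qed.

Lemma hybrid_exponent_init b a c f v : box b a c f ->
  hybrid_exponent b f b 0 v = \sum_(k < b) gap f k v.
Proof.
case=> _ _ _ h0; rewrite /hybrid_exponent/= /diag_sum.
by rewrite [X in _ + (X - _)]big1 ?addn0// => k _; rewrite h0// leq_addr.
Qed.

Lemma hybrid_exponent_final b f v :
  hybrid_exponent b f 0 0 v = diag_sum b f 0 v - diag_sum b f 0 v.+1.
Proof. by rewrite /hybrid_exponent big_ord0. Qed.

(** Each toggle permutes the box, so reindexing by it moves the exponents one cell on, from the last
    row up and from right to left in each row. As [G] takes the whole vector of exponents, they are
    matched jointly. *)
Lemma esum_gap_diag_sum (R : realType) (b a c : nat)
    (G : {ffun 'I_a -> nat} -> \bar R) :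
  (\esum_(f in box b a c) G [ffun v : 'I_a => (\sum_(k < b) gap f k v)%N] =
   \esum_(f in box b a c)
     G [ffun v : 'I_a => (diag_sum b f 0 v - diag_sum b f 0 v.+1)%N])%R.
Proof.
pose S i j :=
  (\esum_(f in box b a c) G [ffun v : 'I_a => hybrid_exponent b f i j v])%R.
transitivity (S b 0).
  apply: eq_esum => f bf; congr G; apply/ffunP => v.
  by rewrite !ffunE (hybrid_exponent_init _ bf).
transitivity (S 0 0); last first.
  apply: eq_esum => f bf; congr G; apply/ffunP => v.
  by rewrite !ffunE hybrid_exponent_final.
have step i j : S i j.+1 = S i j.
  rewrite [RHS](reindex_esum _ _ _ _ (set_involution_bij
    (@toggle_box b a c i j) (@toggleK b a c i j))).
  apply: eq_esum => f bf; congr G; apply/ffunP => v.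
  by rewrite !ffunE (hybrid_exponent_toggle _ _ _ bf).
have row i : S i.+1 0 = S i 0.
  transitivity (S i a); last by elim: (a) => // n IH; rewrite step.
  apply: eq_esum => f bf; congr G; apply/ffunP => v.
  by rewrite !ffunE (hybrid_exponent_row _ bf).
by elim: {1}b => // n IH; rewrite row.
Qed.

(** * Conjugation of rows *)

Lemma eq_from_ltn m n : (forall k, (k < m) = (k < n)) -> m = n.
Proof. by move=> h; have := h m; have := h n; lia. Qed.

(** [P] holds on an initial segment, and the sum is the length of that segment cut off at [n]. *)
Lemma ltn_sum_downset (P : pred nat) n k : (forall j, P j.+1 -> P j) ->
  (k < \sum_(j < n) P j) = (k < n) && P k.
Proof.
move=> dP; have dP' j d : P (j + d) -> P j.
  by elim: d => [|d IH]; rewrite ?addn0// addnS => /dP.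
elim: n => [|n IH]; first by rewrite big_ord0.
rewrite big_ord_recr/=; case: (boolP (P n)) => Pn.
  rewrite (eq_bigr (fun=> 1)); last first.
    by move=> j _; rewrite (dP' j (n - j)) ?subnKC// ltnW.
  rewrite sum_nat_const card_ord muln1 addn1 ltnS; case: leqP => //= kn.
  by rewrite (dP' k (n - k)) ?subnKC.
rewrite addn0 IH ltnS [k <= n]leq_eqVlt; have [->|//] := eqVneq k n.
by rewrite ltnn (negbTE Pn).
Qed.

(* The initial segments [P] and [Q] are nested. *)
Lemma sum_downset_or (P Q : pred nat) n :
  (forall j, P j.+1 -> P j) -> (forall j, Q j.+1 -> Q j) ->
  \sum_(j < n) (P j || Q j) = maxn (\sum_(j < n) P j) (\sum_(j < n) Q j).
Proof.
move=> dP dQ; apply: eq_from_ltn => k; rewrite leq_max.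
rewrite !(ltn_sum_downset _ _ dP, ltn_sum_downset _ _ dQ).
rewrite (@ltn_sum_downset (fun j => P j || Q j)) ?andb_orr//.
by move=> j /orP[/dP ->//|/dQ ->]; rewrite orbT.
Qed.

Definition conj_rows (a : nat) (f : nat -> nat -> nat) (i v : nat) : nat :=
  \sum_(j < a) (v < f i j).

Lemma ltn_conj_rows b a c f i v j : box b a c f ->
  (j < conj_rows a f i v) = (j < a) && (v < f i j).
Proof.
case=> hr _ _ _; apply: (@ltn_sum_downset (fun j => v < f i j)) => k vf.
exact: leq_trans vf (hr _ _).
Qed.

Lemma conj_rows_box b a c f : box b a c f -> box b c a (conj_rows a f).
Proof.
case=> hr hc hle h0; split=> [i v|i v|i v|i v].
- by apply: leq_sum => j _; have := hr i j; lia.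
- by apply: leq_sum => j _; have := hc i j; lia.
- rewrite -[leqRHS]card_ord -sum1_card; apply: leq_sum => j _.
  exact: leq_b1.
- move=> h; apply: big1 => j _; have := hle i j; have := h0 i j; lia.
Qed.

Lemma conj_rowsK b a c f : box b a c f -> conj_rows c (conj_rows a f) = f.
Proof.
move=> bf; apply/funext => i; apply/funext => j; apply: eq_from_ltn => k.
rewrite (ltn_conj_rows _ _ _ (conj_rows_box bf)) (ltn_conj_rows _ _ _ bf).
case: bf => _ _ hle h0; have := hle i j; have := h0 i j; lia.
Qed.

Lemma conj_rows_bij b a c : set_bij (box b a c) (box b c a) (conj_rows a).
Proof.
split=> [f bf|f g|f bf]; first exact: conj_rows_box bf.
  rewrite !inE => bf bg e.
  by rewrite -(conj_rowsK bf) e (conj_rowsK bg).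
exists (conj_rows c f); last exact: conj_rowsK bf.
exact: conj_rows_box bf.
Qed.

(** The maximum counts the columns with [v < f i.+1 j] or [v.+1 < f i j], by nestedness. Removing
    these from the columns with [v < f i j] leaves the descents of value [v.+1]. *)
Lemma gap_conj_rows b a c f i v : box b a c f ->
  gap (conj_rows a f) i v = \sum_(j < a) ((f i j == v.+1) && (f i.+1 j < f i j)).
Proof.
case=> hr hc _ _; rewrite /gap /conj_rows.
rewrite -(@sum_downset_or (fun j => v < f i.+1 j) (fun j => v.+1 < f i j)).
- apply: (canLR (addnK _)); rewrite -big_split/=; apply: eq_bigr => j _.
  by have := hc i j; lia.
- by move=> j; have := hr i.+1 j; lia.
- by move=> j; have := hr i j; lia.
Qed.

(** The value [(v + i).+1] in row [i] stands for the tableau entry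
    [(v + i).+1 + (b - i.+1) = b + v], the position of [q_v] after the [b] ones. *)
Lemma sum_diag_conj_rows b a f v :
  diag_sum b (conj_rows a f) 0 v - diag_sum b (conj_rows a f) 0 v.+1 =
  \sum_(i < b) \sum_(j < a) (f i j == (v + i).+1).
Proof.
apply/esym/(canRL (addnK _)); rewrite /diag_sum -big_split/=.
apply: eq_bigr => i _; rewrite /conj_rows -big_split/=; apply: eq_bigr => j _.
by rewrite add0n; lia.
Qed.

Lemma box_homo b a c f i j k l : box b a c f -> i <= k -> j <= l ->
  f k l <= f i j.
Proof.
case=> hr hc _ _ /subnK <- /subnK <-.
elim: (k - i) => [|d]; last exact/leq_trans/hc.
by elim: (l - j) => // d; exact/leq_trans/hr.
Qed.

(** * Plane partitions with bounded first row as box arrays *)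

Lemma pp_shape0_le b c (p : PP b c) a : (pp_shape p 0 <= a) = (p 0 a == 0).
Proof.
have [N hN] := pp_col_bound p.
(* [fset_set] defaults to the empty set on infinite sets, so finiteness comes before any count. *)
have fin : finite_set [set j | 0 < p 0 j].
  apply: (sub_finite_set _ (finite_II N)) => j /= pj.
  by rewrite ltnNge; apply/negP => /(hN 0) e; rewrite e in pj.
apply/idP/idP => [|/eqP pa]; last first.
  apply: geq_card_fset_set; apply: subset_card_le => j /= pj.
  rewrite ltnNge; apply/negP => /(pp_homo_row p 0).
  by rewrite pa leqNgt pj.
apply: contraLR; rewrite -lt0n -ltnNge => pa.
apply: leq_card_fset_set => //; apply: subset_card_le => j /= ja.
by apply: leq_trans pa _; apply: pp_homo_row.
Qed.

Lemma pp_entry_bij b a c :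
  set_bij [set p : PP b c | pp_shape p 0 <= a] (box b a c) (@pp_entry b c).
Proof.
split=> [p /=|p1 p2 _ _ e|f bf].
- rewrite pp_shape0_le => /eqP pa; split=> [i j|i j|i j|i j /orP[bi|aj]].
  + exact: pp_homo_row.
  + exact: pp_homo_col.
  + exact: pp_le.
  + exact: pp_row0.
  + apply/eqP; rewrite -leqn0 -pa.
    exact: leq_trans (pp_homo_col _ _ (leq0n i)) (pp_homo_row _ _ aj).
- by apply: pp_inj => i j; rewrite e.
- have [hr hc hle h0] := bf.
  have ppf : is_plane_partition f.
    split=> //; apply: (@sub_finite_set _ _ (`I_b `*` `I_a)); last first.
      by apply: finite_setX; exact: finite_II.
    move=> [i j] /= fij; have := h0 i j; lia.
  have rf : ([set i | exists j, 0 < f i j] #<= `I_b)%card.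
    apply: subset_card_le => i /= [j]; have := h0 i j; lia.
  exists (MkPP ppf rf hle) => //=.
  have := pp_shape0_le (MkPP ppf rf hle) a.
  by rewrite /= h0 ?leqnn ?orbT// => ->.
Qed.

Lemma gweight_box (R : realType) b a c (q : c.-tuple R) (p : PP b c) :
  box b a c p ->
  gweight q p =
  (\prod_(v < c) tnth q v ^+ \sum_(i < b) gap (conj_rows a p) i v)%R.
Proof.
move=> bp; have [_ _ _ h0] := bp.
rewrite (@gweight_mult _ _ _ _ a); last by move=> i j aj; rewrite h0// aj orbT.
rewrite -(pair_bigA _ (fun (i : 'I_b) (v : 'I_c) =>
  tnth q v ^+ pp_mult a p i v)%R)/= exchange_big/=.
apply: eq_bigr => v _; rewrite prodrXr; congr (_ ^+ _)%R.
apply: eq_bigr => i _; rewrite (gap_conj_rows _ _ bp) /pp_mult -sum1_card.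
by rewrite big_mkcond/=; apply: eq_bigr => j _; rewrite !inE.
Qed.

(** * Rectangular tableaux as box arrays *)

Section cells.
Variables b a : nat.
Implicit Types u v : cell (nseq b a).

Lemma cell_row_lt u : cell_row u < b.
Proof. by rewrite -[ltnRHS](size_nseq b a) ltn_ord. Qed.

Lemma cell_col_lt u : cell_col u < a.
Proof.
have := ltn_ord (tagged u); rewrite {2}(tnth_nth 0) nth_nseq.
by rewrite cell_row_lt.
Qed.

Lemma cell_inj u v : cell_row u = cell_row v -> cell_col u = cell_col v -> u = v.
Proof.
case: u v => [i j] [i' j']; rewrite /cell_row /cell_col/= => /val_inj e.
by case: i' / e j' => j' /val_inj ->.
Qed.

Lemma cell_exists i j : i < b -> j < a ->
  exists u, cell_row u = i /\ cell_col u = j.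
Proof.
move=> ib ja; have ib' : i < size (nseq b a) by rewrite size_nseq.
have ja' : j < tnth (in_tuple (nseq b a)) (Ordinal ib').
  by rewrite (tnth_nth 0) nth_nseq ib.
by exists (Tagged (fun i => 'I_(tnth (in_tuple (nseq b a)) i)) (Ordinal ja')).
Qed.

Lemma prod_cell (R : comNzRingType) (F : nat -> nat -> R) :
  (\prod_(u : cell (nseq b a)) F (cell_row u) (cell_col u) =
   \prod_(i < b) \prod_(j < a) F i j)%R.
Proof.
rewrite -(sig_big_dep (fun=> true) (fun _ => predT)
  (fun i (j : 'I_(tnth (in_tuple (nseq b a)) i)) => F i j))/=.
transitivity (\prod_(i < size (nseq b a)) \prod_(j < a) F i j)%R.
  apply: eq_bigr => i _; suff -> : tnth (in_tuple (nseq b a)) i = a by [].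
  by rewrite (tnth_nth 0) nth_nseq -[b in _ < b](size_nseq b a) ltn_ord.
by rewrite size_nseq.
Qed.

Section tableau.
Variables n : nat.
Implicit Types T : {ffun cell (nseq b a) -> 'I_n}.

(** Extends [T] to natural coordinates: the sum has one term inside the diagram and none outside. *)
Definition tableau_entry T (i j : nat) : nat :=
  \sum_(u | (cell_row u == i) && (cell_col u == j)) T u.

Lemma tableau_entryE T u : tableau_entry T (cell_row u) (cell_col u) = T u.
Proof.
rewrite /tableau_entry (big_pred1 u)// => v /=.
by apply/andP/eqP => [[/eqP h /eqP k]|->//]; exact: cell_inj.
Qed.

Lemma ltn_tableau_entry T i j : i < b -> j < a -> tableau_entry T i j < n.
Proof.
by move=> ib ja; have [u [<- <-]] := cell_exists ib ja; rewrite tableau_entryE.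
Qed.

Lemma ssyt_row T i j : is_ssyt T -> i < b -> j.+1 < a ->
  tableau_entry T i j <= tableau_entry T i j.+1.
Proof.
move=> sT ib ja.
have [u [ui uj]] := cell_exists ib (ltnW ja).
have [v [vi vj]] := cell_exists ib ja.
rewrite -[X in _ <= tableau_entry _ X _]vi -vj -ui -uj !tableau_entryE.
have /forallP/(_ u)/forallP/(_ v)/andP[+ _] := sT.
by rewrite ui vi uj vj eqxx leqnSn.
Qed.

Lemma ssyt_col T i j : is_ssyt T -> i.+1 < b -> j < a ->
  tableau_entry T i j < tableau_entry T i.+1 j.
Proof.
move=> sT ib ja.
have [u [ui uj]] := cell_exists (ltnW ib) ja.
have [v [vi vj]] := cell_exists ib ja.
rewrite -[X in _ < tableau_entry _ _ X]vj -vi -ui -uj !tableau_entryE.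
have /forallP/(_ u)/forallP/(_ v)/andP[_] := sT.
by rewrite ui vi uj vj eqxx leqnn.
Qed.

End tableau.

Section rectangle.
Variable c : nat.
Implicit Types T : {ffun cell (nseq b a) -> 'I_(b + c)}.

Definition ssyt_box T (i j : nat) : nat :=
  if (i < b) && (j < a)
  then tableau_entry T (b - i.+1) (a - j.+1) - (b - i.+1) else 0.

Lemma ssyt_ge_row T i j : is_ssyt T -> i < b -> j < a -> i <= tableau_entry T i j.
Proof.
move=> sT + ja; elim: i => // i IH ib.
exact: leq_ltn_trans (IH (ltnW ib)) (ssyt_col sT ib ja).
Qed.

(** Going down to the last row raises the entry by at least [b - i.+1], and it stays below
    [b + c]. *)
Lemma ssyt_le_row T i j : is_ssyt T -> i < b -> j < a ->
  tableau_entry T i j <= i + c.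
Proof.
move=> sT ib ja.
have h d : i + d < b -> tableau_entry T i j + d <= tableau_entry T (i + d) j.
  elim: d => [|d IH]; first by rewrite !addn0.
  by rewrite !addnS => id; apply: leq_ltn_trans (IH (ltnW id)) (ssyt_col sT id ja).
have id : i + (b - i.+1) < b by lia.
have := h _ id; have := ltn_tableau_entry T id ja; lia.
Qed.

Lemma ssyt_box_bij : set_bij [set T | is_ssyt T] (box b a c) ssyt_box.
Proof.
split=> [T sT|T1 T2|f bf].
- have sub i : b - i.+1 = if i.+1 < b then (b - i.+2).+1 else 0.
    by case: ifP; lia.
  have suba j : a - j.+1 = if j.+1 < a then (a - j.+2).+1 else 0.
    by case: ifP; lia.
  split=> i j; rewrite /ssyt_box.
  + case: ifPn => // /andP[ib ja]; rewrite ib (ltnW ja)/=.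
    rewrite (suba j) ja; apply: leq_sub2r; apply: ssyt_row => //; lia.
  + case: ifPn => // /andP[ib ja]; rewrite (ltnW ib) ja/=.
    rewrite (sub i) ib.
    have h : (b - i.+2).+1 < b by lia.
    have ja' : a - j.+1 < a by lia.
    by have := ssyt_col sT h ja'; lia.
  + case: ifPn => // /andP[ib ja].
    have ib' : b - i.+1 < b by lia.
    have ja' : a - j.+1 < a by lia.
    by have := ssyt_le_row sT ib' ja'; lia.
  + by case: ifPn => //; lia.
- rewrite !inE => s1 s2 e; apply/ffunP => u; apply/val_inj => /=.
  have ub := cell_row_lt u; have ua := cell_col_lt u.
  have := congr1 (fun f => f (b - (cell_row u).+1) (a - (cell_col u).+1)) e.
  rewrite /ssyt_box !ifT; try lia.
  rewrite !subnSK// !subKn ?(ltnW ub) ?(ltnW ua)// !tableau_entryE.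
  have := ssyt_ge_row s1 ub ua; have := ssyt_ge_row s2 ub ua.
  by rewrite !tableau_entryE; lia.
- have [_ _ hle h0] := bf.
  (* The inverse map: rotate back and restore the row index. *)
  pose t u := f (b - (cell_row u).+1) (a - (cell_col u).+1) + cell_row u.
  have lt_t u : t u < b + c.
    by rewrite /t addnC -addSn leq_add ?cell_row_lt.
  exists [ffun u => Ordinal (lt_t u)] => /=.
    apply/forallP => u; apply/forallP => v; rewrite !ffunE/= /t.
    apply/andP; split; apply/implyP => /andP[/eqP e1 e2].
      by rewrite e1 leq_add2r; apply: box_homo bf _ _; lia.
    rewrite e1 -addnS; apply: leq_add => //.
    by apply: box_homo bf _ _; lia.
  apply/funext => i; apply/funext => j; rewrite /ssyt_box.
  case: ifPn => [/andP[ib ja]|h]; last by rewrite h0//; lia.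
  have [||u [ui uj]] := @cell_exists (b - i.+1) (a - j.+1); try lia.
  rewrite -{1}ui -uj tableau_entryE ffunE/= /t ui uj addnK.
  by rewrite !subnSK// !subKn// ltnW.
Qed.

Lemma prod_ssyt (R : comNzRingType) (q : c.-tuple R) T : is_ssyt T ->
  (\prod_u tnth [tuple of nseq b 1 ++ q] (T u) =
   \prod_(v < c) tnth q v ^+
     \sum_(i < b) \sum_(j < a) (ssyt_box T i j == (v + i).+1))%R.
Proof.
move=> sT; pose x := nseq b 1%R ++ q.
(* A box value [k] in row [i] selects a variable 1 if [k <= i], and otherwise the entry [k - i.+1]
   of [q]; hence at most one factor on the right is nontrivial. *)
have xE i k : i < b -> k <= c ->
    (x`_(k + (b - i.+1)) = \prod_(v < c) tnth q v ^+ (k == (v + i).+1))%R.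
  move=> ib kc; rewrite /x nth_cat size_nseq nth_nseq.
  case: ltnP => h.
    by rewrite big1// => v _; rewrite (_ : _ == _ = false) ?expr0//; lia.
  have kc' : k - i.+1 < c by lia.
  rewrite (bigD1 (Ordinal kc'))//= [X in (_ * X)%R]big1 ?mulr1.
    rewrite (tnth_nth 0%R)/= (_ : k == _ = true) ?expr1; last by lia.
    by congr nth; lia.
  move=> v /eqP vk; rewrite (_ : _ == _ = false) ?expr0//; apply/eqP => e.
  by apply: vk; apply/val_inj => /=; lia.
transitivity (\prod_(i < b) \prod_(j < a) x`_(tableau_entry T i j))%R.
  rewrite -(prod_cell (fun i j => x`_(tableau_entry T i j))%R).
  by apply: eq_bigr => u _; rewrite tableau_entryE (tnth_nth 0%R).
rewrite (reindex_inj rev_ord_inj)/=.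
transitivity (\prod_(i < b) \prod_(j < a) \prod_(v < c)
    tnth q v ^+ (ssyt_box T i j == (v + i).+1))%R.
  apply: eq_bigr => i _; rewrite (reindex_inj rev_ord_inj)/=.
  apply: eq_bigr => j _; have ib := ltn_ord i; have ja := ltn_ord j.
  have [_ _ hle _] : box b a c (ssyt_box T) by case: ssyt_box_bij => + _ _; apply.
  rewrite -xE//; congr (x`_ _)%R; rewrite /ssyt_box ib ja/= subnK//.
  by apply: ssyt_ge_row => //; lia.
rewrite [RHS](eq_bigr (fun v : 'I_c => \prod_(i < b) \prod_(j < a)
    tnth q v ^+ (ssyt_box T i j == (v + i).+1))%R); last first.
  by move=> v _; rewrite -prodrXr; apply: eq_bigr => i _; rewrite prodrXr.
by rewrite [RHS]exchange_big/=; apply: eq_bigr => i _; rewrite exchange_big.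
Qed.

End rectangle.
End cells.

Local Open Scope ring_scope.

Theorem theorem7p3 (R : realType) (a b c : nat)
  (ha : (0 < a)%N) (hb : (0 < b)%N) (hc : (0 < c)%N)
  (q : c.-tuple R) (hq : forall k : 'I_c, 0 < tnth q k < 1) :
  (gmeasure hq : probability (PP b c) R)
    [set pi : PP b c | (pp_shape pi 0 <= a)%N] =
  ((gZ b q)^-1 * schur (nseq b a) [tuple of nseq b 1 ++ q])%:E.
Proof.
pose G (e : {ffun 'I_c -> nat}) : \bar R :=
  ((gZ b q)^-1 * \prod_v tnth q v ^+ e v)%:E.
have q0 v : 0 <= tnth q v by case/andP: (hq v) => /ltW.
(* Conjugated arrays have [c] columns, so column [v] carries the exponent of [q_v]. *)
transitivity
  (\esum_(f in box b c a) G [ffun v : 'I_c => (\sum_(k < b) gap f k v)%N]).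
  rewrite (reindex_esum _ _ _ _ (conj_rows_bij b a c)).
  rewrite (reindex_esum _ _ _ _ (pp_entry_bij b a c)).
  apply: eq_esum => p ap; rewrite (@gweight_box _ _ a); last first.
    by case: (pp_entry_bij b a c) => + _ _; apply.
  by congr (_ * _)%:E; apply: eq_bigr => v _; rewrite ffunE.
rewrite esum_gap_diag_sum.
rewrite (reindex_esum _ _ _ _ (conj_rows_bij b a c)).
rewrite (reindex_esum _ _ _ _ (ssyt_box_bij b a c)).
rewrite esum_fset; [|exact: finite_finset|]; last first.
  move=> T _; rewrite lee_fin; apply: mulr_ge0.
    by rewrite invr_ge0 ltW// gZ_gt0.
  by apply: prodr_ge0 => v _; rewrite exprn_ge0.
rewrite /schur mulr_sumr -sumEFin -(bigfs _ (index_enum_uniq _))//; last first.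
  by move=> T _; rewrite mem_index_enum.
apply: eq_bigr => T sT; rewrite (prod_ssyt q sT).
by congr (_ * _)%:E; apply: eq_bigr => v _; rewrite ffunE sum_diag_conj_rows.
Qed.
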